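(* Let $G$ be a group which is hyperbolic relative to the peripheral subgroups $\mathcal{H}=\{H_i\}_{i\in I}$, with finite generating set $X$. There is a cubic polynomial $\mathcal{Q}$ such that for any two conjugate hyperbolic elements $a,b\in G$, there exists $x\in G$ such that $x^{-1}ax=b$ and $\|x\|_X\le\mathcal{Q}(\mathcal{L})$, where $\mathcal{L}=\max\{\|a\|_X,\|b\|_X\}$.
   Context: Let $G$ be a finitely generated group with finite generating set $X$ and let $\mathcal{H}=\{H_i\}_{i\in I}$ be a set of subgroups of $G$ (the peripheral subgroups). $\|x\|_X$ is the word length of $x$ with respect to $X$. $\Gamma=\Gamma(G,X)$ is the Cayley graph with path metric $d_\Gamma$, and $\widehat{\Gamma}=\Gamma(G,X\cup\mathcal{H})$ is the coned-off Cayley graph, i.e. the Cayley graph of $G$ with respect to $X\cup\bigcup_{i}H_i$, with path metric $d_{\widehat\Gamma}$. Relative hyperbolicity (Farb): $G$ is weakly relatively hyperbolic with respect to $\mathcal{H}$ if $\widehat\Gamma$ is a hyperbolic metric space. A relative (quasi-)geodesic is a (quasi-)geodesic in $\widehat\Gamma$. An $H_i$-component of a path is a maximal subpath labelled by an element of $H_i$; a path penetrates a coset $gH_i$ if it has an $H_i$-component in that coset. Two $H_i$-components $s,t$ are connected if there is a path from the origin $s_-$ to the origin $t_-$ labelled by an element of $H_i$; a component of a single path is isolated if no distinct $H_i$-component of that path is connected to it; a path is without backtracking if all its $H_i$-components (for all $i$) are isolated. The Bounded Coset Penetration property (BCP) says: for any $\lambda$ there is a constant $c(\lambda)$ such that for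 any two relative $(\lambda,0)$-quasi-geodesics $p,q$ without backtracking with the same endpoints, (1) if both penetrate the same coset then they enter (and leave) it a $\Gamma$-distance at most $c(\lambda)$ apart; (2) if $p$ penetrates a coset $gH_i$ which $q$ does not penetrate, then $p$ travels a $\Gamma$-distance at most $c(\lambda)$ in $gH_i$. $G$ is hyperbolic relative to $\mathcal{H}$ if it is weakly relatively hyperbolic with respect to $\mathcal{H}$ and satisfies BCP. In this case $\mathcal{H}$ is finite and each $H_i$ is finitely generated. An element $g\in G$ is parabolic if it is conjugate in $G$ to some element of one of the peripheral subgroups $H_i$; otherwise it is hyperbolic. *)

(* Defs.v *)
From mathcomp Require Import all_boot all_order all_algebra.
From mathcomp Require Import all_classical reals.

Set Implicit Arguments.
Unset Strict Implicit.
Unset Printing Implicit Defensive.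

Import Order.TTheory GRing.Theory Num.Theory.
Local Open Scope classical_set_scope.

Section CayleyGraph.
Variable G : groupType.
Implicit Types (S : set G) (x y : G) (w : seq G).

(* The labels of the oriented edges of the Cayley graph of [G] with respect
   to [S]: an edge may be traversed in either direction. *)
Definition letter S x : Prop := S x \/ S x^-1%g.

Definition word_of S w x : Prop :=
  (forall s, s \in w -> letter S s) /\ (\prod_(s <- w) s)%g = x.

Definition generates S : Prop := forall x, exists w, word_of S w x.

Definition has_word_of_size S x (n : nat) : Prop :=
  exists2 w, word_of S w x & size w = n.

(* The length of a shortest word over [S] and its inverses representing [x]
   (junk value 0 when there is none, which cannot happen if [S] generates). *)
Definition word_length S x : nat :=
  if pselect (exists n, `[< has_word_of_size S x n >]) is left ex
  then ex_minn ex else 0.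

(* The path metric of the Cayley graph, on vertices. *)
Definition cayley_dist S x y : nat := word_length S (x^-1 * y)%g.

(* An edge path: its origin and the word read along it. *)
Record epath := EPath { origin : G; label : seq G }.

Implicit Types p q r : epath.

Definition path_in S p : Prop := forall s, s \in label p -> letter S s.

Definition plen p : nat := size (label p).

Definition vertex p (k : nat) : G :=
  (origin p * \prod_(s <- take k (label p)) s)%g.

Definition terminus p : G := vertex p (plen p).

Definition geodesic S p : Prop :=
  path_in S p /\ plen p = cayley_dist S (origin p) (terminus p).

End CayleyGraph.

Section Hyperbolicity.
Variables (R : realType) (G : groupType).
Implicit Types (S : set G) (p q r : epath G).
Local Open Scope ring_scope.

(* For edge paths parametrized by length the other quasi-isometry inequality
   is automatic. *)
Definition quasi_geodesic S (lambda c : R) p : Prop :=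
  path_in S p /\
  forall j k : nat, (j <= k <= plen p)%N ->
    (k - j)%N%:R <= lambda * (cayley_dist S (vertex p j) (vertex p k))%:R + c.

(* Slim triangles (Rips), for edge-path geodesics with vertices in [G]; points
   interior to edges only change delta by a bounded amount.  By cyclic
   symmetry of the hypotheses it is enough to bound the first side. *)
Definition hyperbolic_cayley_graph S : Prop :=
  exists delta : R, forall p q r,
    geodesic S p -> geodesic S q -> geodesic S r ->
    terminus p = origin q -> terminus q = origin r -> terminus r = origin p ->
    forall k : nat, (k <= plen p)%N ->
      (exists2 l : nat, (l <= plen q)%N &
         (cayley_dist S (vertex p k) (vertex q l))%:R <= delta) \/
      (exists2 l : nat, (l <= plen r)%N &
         (cayley_dist S (vertex p k) (vertex r l))%:R <= delta).

End Hyperbolicity.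

Section Components.
Variable G : groupType.
Implicit Types (K : set G) (p : epath G) (g : G).

(* Subpaths of [p] are given by the indices [j], [k] of their end vertices. *)
Definition labelled_in K p (j k : nat) : Prop :=
  forall m : nat, (j <= m < k)%N -> K (nth 1%g (label p) m).

Definition component K p (j k : nat) : Prop :=
  [/\ (j < k <= plen p)%N, labelled_in K p j k &
      forall j' k' : nat, (j' <= j)%N -> (k <= k' <= plen p)%N ->
        labelled_in K p j' k' -> j' = j /\ k' = k].

(* Components with origins [x] and [y] are connected when a (possibly trivial)
   path labelled by an element of [K] joins [x] to [y]. *)
Definition connected_origins K (x y : G) : Prop := K (x^-1 * y)%g.

Definition isolated K p (j k : nat) : Prop :=
  forall j' k' : nat, component K p j' k' ->
    connected_origins K (vertex p j) (vertex p j') -> j' = j /\ k' = k.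

Definition lcoset_set g K : set G := [set (g * h)%g | h in K].

Definition component_in_coset K g p (j k : nat) : Prop :=
  component K p j k /\ lcoset_set g K (vertex p j).

Definition penetrates K g p : Prop :=
  exists j k : nat, component_in_coset K g p j k.

End Components.

Section RelativeHyperbolicity.
Variables (R : realType) (G : groupType) (X : set G).
Variables (I : Type) (H : I -> set G).
Implicit Types (p q : epath G) (g : G).
Local Open Scope ring_scope.

Definition coned_off_generators : set G := X `|` \bigcup_i H i.

Definition without_backtracking p : Prop :=
  forall i (j k : nat), component (H i) p j k -> isolated (H i) p j k.

Definition weakly_relatively_hyperbolic : Prop :=
  hyperbolic_cayley_graph R coned_off_generators.

(* The case lambda < 1 is omitted: only one-vertex paths are
   (lambda, 0)-quasi-geodesics then. *)
Definition bounded_coset_penetration : Prop :=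
  forall lambda : R, 1 <= lambda -> exists c : R, forall p q,
    quasi_geodesic coned_off_generators lambda 0 p ->
    quasi_geodesic coned_off_generators lambda 0 q ->
    without_backtracking p -> without_backtracking q ->
    origin p = origin q -> terminus p = terminus q ->
    (forall i g (j k j' k' : nat),
       component_in_coset (H i) g p j k ->
       component_in_coset (H i) g q j' k' ->
       (cayley_dist X (vertex p j) (vertex q j'))%:R <= c /\
       (cayley_dist X (vertex p k) (vertex q k'))%:R <= c) /\
    (forall i g (j k : nat),
       component_in_coset (H i) g p j k -> ~ penetrates (H i) g q ->
       (cayley_dist X (vertex p j) (vertex p k))%:R <= c).

Definition relatively_hyperbolic : Prop :=
  weakly_relatively_hyperbolic /\ bounded_coset_penetration.

Definition parabolic g : Prop :=
  exists i, exists2 h, H i h & exists x, g = (h ^ x)%g.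

Definition hyperbolic_element g : Prop := ~ parabolic g.

End RelativeHyperbolicity.

(* Main.v *)
Require Import Defs.
From mathcomp Require Import all_boot all_order all_algebra.
From mathcomp Require Import all_classical reals.
From mathcomp Require Import zify.

(** Write d for the metric of the coned-off Cayley graph and d_X for that of
    the Cayley graph.  Bounded coset penetration makes the nearest-point
    projection to a peripheral coset C coarsely Lipschitz: an edge of the
    coned-off graph not contained in C moves the projection by at most a
    constant in d_X.  Since a geodesic enters and leaves C at projections of
    its ends, an edge of it lying in C is short in d_X as soon as its ends can
    be joined by a short path with no long edge in C.

    Let x be a conjugator of minimal length n in the coned-off graph and p a
    geodesic from 1 to x.  Minimality gives d(p_i, a p_j) >= |i - j|, so by
    slimness p and its translate a p are synchronously close away from the
    ends, and they share no edge of a coset, since otherwise a would be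
    parabolic.  Going around through a p then bounds in d_X, in the middle of
    p, first the edges of p and next p_k^-1 a p_k.  The latter are pairwise
    distinct, so n <= 2 L + constant because balls of d_X are finite.  Going
    around along the words a and b bounds every edge of p linearly in n + L,
    whence a quadratic bound for x. *)

Set Implicit Arguments.
Unset Strict Implicit.
Unset Printing Implicit Defensive.

Import GRing.Theory Num.Theory.

(** * Word metrics, with geodesics as sequences of vertices *)

Section WordMetric.
Local Open Scope group_scope.
Variables (G : groupType) (S : set G).
Hypothesis genS : generates S.
Implicit Types (x y z : G) (f : nat -> G).

Lemma letterV x : letter S x -> letter S x^-1.
Proof. by case=> Sx; [right; rewrite invgK|left]. Qed.

Lemma word_length_le w x : word_of S w x -> word_length S x <= size w.
Proof.
move=> wx; rewrite /word_length; case: pselect => [ex|//].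
case: ex_minnP => m _; apply; apply/asboolP; by exists w.
Qed.

Lemma word_lengthP x : exists2 w, word_of S w x & size w = word_length S x.
Proof.
rewrite /word_length; case: pselect => [ex|nex].
  by case: ex_minnP => m /asboolP[w wx <-] _; exists w.
have [w wx] := genS x; case: nex; exists (size w); apply/asboolP; by exists w.
Qed.

Lemma word_length1 : word_length S 1 = 0.
Proof.
apply/eqP; rewrite -leqn0; apply: (@word_length_le [::]).
by split=> //; rewrite big_nil.
Qed.

Lemma word_length_eq0 x : word_length S x = 0 -> x = 1.
Proof. by have [w [_ <-] <-] := word_lengthP x => /size0nil ->; rewrite big_nil. Qed.

Lemma word_length_letter x : letter S x -> word_length S x <= 1.
Proof.
move=> Sx; apply: (@word_length_le [:: x]); split; last by rewrite big_seq1.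
by move=> s; rewrite inE => /eqP ->.
Qed.

Lemma word_lengthM x y : word_length S (x * y) <= word_length S x + word_length S y.
Proof.
have [v [Sv <-] <-] := word_lengthP x; have [w [Sw <-] <-] := word_lengthP y.
rewrite -size_cat; apply: word_length_le; split; last by rewrite big_cat.
by move=> s; rewrite mem_cat => /orP[/Sv|/Sw].
Qed.

Lemma word_lengthV_le x : word_length S x^-1 <= word_length S x.
Proof.
have [w [Sw <-] <-] := word_lengthP x.
elim: w Sw => [|s w IH] Sw; first by rewrite big_nil invg1 word_length1.
rewrite big_cons invgM (leq_trans (word_lengthM _ _)) //= -addn1.
apply: leq_add; first by apply: IH => t tw; apply: Sw; rewrite inE tw orbT.
by apply/word_length_letter/letterV/Sw; rewrite inE eqxx.
Qed.

Lemma word_lengthV x : word_length S x^-1 = word_length S x.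
Proof.
by apply/eqP; rewrite eqn_leq word_lengthV_le -{1}[x]invgK word_lengthV_le.
Qed.

Lemma letter_word_length1 x : word_length S x = 1%N -> letter S x.
Proof.
have [w [Sw <-] <-] := word_lengthP x.
by case: w Sw => [|s []] //= Sw _; rewrite big_seq1; apply: Sw; rewrite inE eqxx.
Qed.

Local Notation d := (cayley_dist S).

Lemma dist1 x : d 1 x = word_length S x.
Proof. by rewrite /cayley_dist invg1 mul1g. Qed.

Lemma distxx x : d x x = 0.
Proof. by rewrite /cayley_dist mulVg word_length1. Qed.

Lemma dist_eq0 x y : d x y = 0 -> x = y.
Proof. by move/word_length_eq0/mulg1_eq; rewrite invgK. Qed.

Lemma distC x y : d x y = d y x.
Proof. by rewrite /cayley_dist -word_lengthV invgM invgK. Qed.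

Lemma dist_triangle y x z : d x z <= d x y + d y z.
Proof.
rewrite /cayley_dist; apply: leq_trans (word_lengthM _ _).
by rewrite mulgA mulgK.
Qed.

Lemma dist_mull a x y : d (a * x) (a * y) = d x y.
Proof. by rewrite /cayley_dist invgM mulgA mulgVK. Qed.

Lemma dist_chain f n B : (forall k, k < n -> d (f k) (f k.+1) <= B) ->
  d (f 0%N) (f n) <= n * B.
Proof.
elim: n => [|n IH] step; first by rewrite distxx.
apply: leq_trans (dist_triangle (f n) _ _) _.
by rewrite mulSn addnC leq_add ?step // IH // => k kn; apply/step/ltnW.
Qed.

(** Sequences instead of edge paths make subpaths and translates plain functions; values after [n]
    are unconstrained. *)
Definition geod f n := forall i j, i <= j <= n -> d (f i) (f j) = j - i.

Lemma geod_prefix f n i j : geod f n -> i + j <= n -> geod (fun k => f (i + k)) j.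
Proof. by move=> gf ijn k l /andP[kl lj]; rewrite gf; lia. Qed.

Lemma geod_mull a f n : geod f n -> geod (fun k => a * f k) n.
Proof. by move=> gf k l kl; rewrite dist_mull gf. Qed.

Lemma geod_exists x y :
  exists f, [/\ f 0 = x, f (d x y) = y & geod f (d x y)].
Proof.
have [w [Sw wE] sw] := word_lengthP (x^-1 * y).
pose f k := x * \prod_(s <- take k w) s.
have f0 : f 0 = x by rewrite /f take0 big_nil mulg1.
have fn : f (d x y) = y.
  by rewrite /f /cayley_dist -sw take_size wE mulVKg.
have step k : d (f k) (f k.+1) <= 1.
  have [kw|kw] := ltnP k (size w); last by rewrite /f !take_oversize ?distxx //; lia.
  rewrite /f (take_nth 1) // -cats1 big_cat big_seq1 /= dist_mull.
  rewrite /cayley_dist mulKg; apply/word_length_letter/Sw; exact: mem_nth.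
have le i k : d (f i) (f (i + k)) <= k.
  have := @dist_chain (fun l => f (i + l)) k 1; rewrite addn0 muln1; apply=> l _.
  by rewrite addnS.
(* Unit steps bound every stretch from above; since the whole path spans [d x y], no stretch can be
   shorter. *)
exists f; split=> // i j /andP[ij jn].
have := le i (j - i); have := le 0 i; have := le j (d x y - j).
rewrite !subnKC // add0n f0 fn.
have := dist_triangle (f i) x y; have := dist_triangle (f j) (f i) y; lia.
Qed.

Lemma finite_ball (fS : finite_set S) m :
  exists s : seq G, forall x, word_length S x <= m -> x \in s.
Proof.
have /finite_seqP[t St] := fS.
have tP x : letter S x -> x \in t ++ [seq y^-1 | y <- t].
  by rewrite mem_cat St => -[|] /= xt; apply/orP; [left|right; apply/mapP; exists x^-1;
    rewrite ?invgK].
elim: m => [|m [s sP]].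
  by exists [:: 1] => x; rewrite leqn0 inE => /eqP/word_length_eq0 ->.
exists (1 :: [seq y * z | y <- t ++ [seq y^-1 | y <- t], z <- s]) => x.
have [w [Sw <-] <-] := word_lengthP x; case: w Sw => [|y w] Sw.
  by rewrite big_nil inE eqxx.
rewrite big_cons ltnS inE => wm; apply/orP; right; apply/allpairsP.
exists (y, \prod_(z <- w) z); split=> //=.
  by apply/tP/Sw; rewrite inE eqxx.
apply/sP/(leq_trans _ wm)/word_length_le; split=> // z zw.
by apply: Sw; rewrite inE zw orbT.
Qed.

End WordMetric.

(** * Edge paths and peripheral components *)

Section EdgePaths.
Local Open Scope group_scope.
Variables (G : groupType) (S : set G).
Hypothesis genS : generates S.
Implicit Types (K : set G) (x y z g : G) (f h : nat -> G) (p : epath G).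
Local Notation d := (cayley_dist S).

(** The bridge from vertex sequences to the labelled paths in which slimness and bounded coset
    penetration are phrased. *)
Definition epath_of f n : epath G :=
  EPath (f 0%N) (mkseq (fun k => (f k)^-1 * f k.+1) n).

Lemma plen_epath f n : plen (epath_of f n) = n.
Proof. by rewrite /plen size_mkseq. Qed.

Lemma nth_epath f n k : k < n -> nth 1 (label (epath_of f n)) k = (f k)^-1 * f k.+1.
Proof. by move=> kn; rewrite nth_mkseq. Qed.

Lemma vertexS p k : k < plen p -> vertex p k.+1 = vertex p k * nth 1 (label p) k.
Proof.
by move=> kp; rewrite /vertex (take_nth 1) // -cats1 big_cat big_seq1 mulgA.
Qed.

Lemma vertex_epath f n k : k <= n -> vertex (epath_of f n) k = f k.
Proof.
elim: k => [|k IH] kn; first by rewrite /vertex take0 big_nil mulg1.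
by rewrite vertexS ?plen_epath // IH ?nth_epath ?mulVKg // ltnW.
Qed.

Lemma path_in_epath f n :
  (forall k, k < n -> d (f k) (f k.+1) = 1%N) -> path_in S (epath_of f n).
Proof.
move=> step s /(nthP 1)[k]; rewrite -/(plen _) plen_epath => kn.
by rewrite nth_epath // => <-; apply/(letter_word_length1 genS)/step.
Qed.

Lemma geodesic_epath f n : geod S f n -> geodesic S (epath_of f n).
Proof.
move=> gf; split; first by apply: path_in_epath => k kn; rewrite gf; lia.
by rewrite /terminus plen_epath vertex_epath // gf /=; lia.
Qed.

Lemma quasi_geodesic_epath (R : realType) f n :
  (forall k, k < n -> d (f k) (f k.+1) <= 1) ->
  (forall j k, j <= k <= n -> k - j <= 2 * d (f j) (f k)) ->
  quasi_geodesic S (2%:R : R)%R 0%R (epath_of f n).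
Proof.
move=> step qf; split=> [|j k].
  (* The lower bound at consecutive indices excludes distance 0, so every label is a letter. *)
  by apply: path_in_epath => k kn; have := step k kn; have := qf k k.+1; lia.
rewrite plen_epath => jkn; rewrite !vertex_epath; try lia.
by rewrite addr0 -natrM ler_nat qf.
Qed.

Variable K : set G.
Hypothesis gK : group_closed [in K].

Lemma group_set1 : K 1.
Proof. by case: gK => /set_mem. Qed.

Lemma group_setV x : K x -> K x^-1.
Proof. by move=> Kx; apply/set_mem/(group_closedV gK)/mem_set. Qed.

Lemma group_setM x y : K x -> K y -> K (x * y).
Proof. by move=> Kx Ky; apply/set_mem/(group_closedM gK); apply/mem_set. Qed.

Lemma group_set_trans y x z : K (x^-1 * y) -> K (y^-1 * z) -> K (x^-1 * z).
Proof. by move=> xy yz; have := group_setM xy yz; rewrite mulgA mulgK. Qed.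

Lemma group_set_sym x y : K (x^-1 * y) -> K (y^-1 * x).
Proof. by move=> /group_setV; rewrite invgM invgK. Qed.

Lemma lcoset_setE g x : lcoset_set g K x <-> K (g^-1 * x).
Proof.
split=> [[h Kh <-]|Kx]; first by rewrite mulKg.
by exists (g^-1 * x); rewrite ?mulVKg.
Qed.

Lemma labelled_vertex p j k : j <= k <= plen p -> labelled_in K p j k ->
  K ((vertex p j)^-1 * vertex p k).
Proof.
move=> /andP[/subnKC <-]; elim: (k - j) => [|l IH].
  by rewrite addn0 mulVg => _ _; apply: group_set1.
rewrite addnS => jl lab; rewrite vertexS // mulgA; apply: group_setM.
  by apply: IH => [|m mj]; [exact: ltnW|apply: lab; lia].
by apply: lab; lia.
Qed.

(** The union of two overlapping or adjacent stretches labelled in [K] is again labelled in [K], so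
    by maximality both equal it. *)
Lemma component_eq p j k j' k' : component K p j k -> component K p j' k' ->
  j <= j' <= k -> j = j' /\ k = k'.
Proof.
move=> [jk lab mx] [jk' lab' mx'] jj.
have labU : labelled_in K p j (maxn k k').
  move=> m mb; have [mk|mk] := ltnP m k; first by apply: lab; lia.
  by apply: lab'; lia.
have b1 : k <= maxn k k' <= plen p by lia.
have b2 : k' <= maxn k k' <= plen p by lia.
have j'j : j <= j' by case/andP: jj.
have [_ e1] := mx j _ (leqnn j) b1 labU.
have [e2 e3] := mx' j _ j'j b2 labU.
by split; last exact: etrans (esym e1) e3.
Qed.

(* Two distinct components lie at least three edges apart from the origin of
   the first to the end of the second, too far for a (2,0)-quasi-geodesic if
   both ends are in the same coset. *)
Lemma quasi_geodesic_isolated (R : realType) p j k :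
  (forall x, K x -> letter S x) ->
  quasi_geodesic S (2%:R : R)%R 0%R p -> component K p j k -> isolated K p j k.
Proof.
move=> KS [_ qp].
have qn a b : a <= b <= plen p -> b - a <= 2 * d (vertex p a) (vertex p b).
  by move=> /qp; rewrite addr0 -natrM ler_nat.
have far a b a' b' : component K p a b -> component K p a' b' ->
    connected_origins K (vertex p a) (vertex p a') -> a <= a' -> a = a' /\ b = b'.
  move=> cp cp' con aa.
  have [a'b|ba'] := leqP a' b; first by apply: (component_eq cp cp'); rewrite aa.
  case: (cp) (cp') => [ab _ _] [ab' lab' _].
  have /labelled_vertex/(_ lab') K' : a' <= b' <= plen p by lia.
  have := word_length_letter (KS _ (group_set_trans con K')).
  by have := qn a b'; rewrite /cayley_dist; lia.
move=> cp j' k' cp' con; have [jj|jj] := leqP j j'.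
  by have [] := far _ _ _ _ cp cp' con jj.
by have [] := far _ _ _ _ cp' cp (group_set_sym con) (ltnW jj).
Qed.

End EdgePaths.

(** * Nearest-point projection to a subset *)

Section Projection.
Local Open Scope group_scope.
Variables (G : groupType) (X S : set G).
Hypotheses (genX : generates X) (genS : generates S).
Implicit Types (C : set G) (x y z u v w : G) (f : nat -> G) (B c : nat).
Local Notation d := (cayley_dist S).
Local Notation dX := (cayley_dist X).

Definition nearest C x u := C u /\ forall w, C w -> d x u <= d x w.

(* Nearest points are taken in the metric of [S], but the distance between them
   is measured in that of [X]. *)
Definition proj_close C x y B :=
  forall u v, nearest C x u -> nearest C y v -> dX u v <= B.

Lemma nearest_exists C x w : C w -> exists u, nearest C x u.
Proof.
move=> Cw; pose P n := `[< exists2 u, C u & d x u = n >].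
have ex : exists n, P n by exists (d x w); apply/asboolP; exists w.
case: (ex_minnP ex) => _ /asboolP[u Cu <-] min_u; exists u; split=> // v Cv.
by apply: min_u; apply/asboolP; exists v.
Qed.

Lemma nearest_id C x u : C x -> nearest C x u -> u = x.
Proof.
move=> Cx [_ /(_ x Cx)]; rewrite (distxx S) leqn0 => /eqP.
by move/(dist_eq0 genS) ->.
Qed.

Lemma proj_closeC C x y B : proj_close C x y B -> proj_close C y x B.
Proof. by move=> xy u v nu nv; rewrite distC // xy. Qed.

Lemma proj_closeW C x y B B' : B <= B' -> proj_close C x y B -> proj_close C x y B'.
Proof. by move=> BB xy u v nu nv; apply: leq_trans (xy _ _ nu nv) BB. Qed.

Lemma proj_close_trans C y x z B B' :
  proj_close C x y B -> proj_close C y z B' -> proj_close C x z (B + B').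
Proof.
move=> xy yz u v nu nv; have [w nw] := nearest_exists y (proj1 nu).
by apply: leq_trans (dist_triangle genX w _ _) (leq_add (xy _ _ nu nw) (yz _ _ nw nv)).
Qed.

Lemma proj_close_both C x y B : C x -> C y -> dX x y <= B -> proj_close C x y B.
Proof. by move=> Cx Cy xy u v /(nearest_id Cx) -> /(nearest_id Cy) ->. Qed.

Variable c : nat.

(* This is the only consequence of bounded coset penetration that is used. *)
Definition proj_lipschitz C :=
  forall x y, d x y <= 1 -> ~ (C x /\ C y) -> proj_close C x y c.

(** A vertex outside [C] may have several nearest points; [d x y <= 1] in [proj_lipschitz] includes
    [x = y] and so bounds their distance. *)
Lemma proj_close_refl C x : proj_lipschitz C -> proj_close C x x c.
Proof.
move=> lipC; have [Cx|nCx] := pselect (C x).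
  by apply: proj_close_both; rewrite // (distxx X).
by apply: lipC; rewrite ?(distxx S) // => -[].
Qed.

(** An edge costs at most [B] inside [C] and at most [c] otherwise; the final [c] pays for
    non-unique nearest points when [n = 0]. *)
Lemma proj_close_chain C f n B : proj_lipschitz C ->
  (forall k, k < n -> d (f k) (f k.+1) <= 1) ->
  (forall k, k < n -> C (f k) -> C (f k.+1) -> dX (f k) (f k.+1) <= B) ->
  proj_close C (f 0%N) (f n) (n * (c + B) + c).
Proof.
move=> lipC step stepC; elim: n step stepC => [|n IH] step stepC.
  exact: proj_close_refl.
have -> : n.+1 * (c + B) + c = (n * (c + B) + c) + (c + B) by rewrite mulSn; lia.
apply: (@proj_close_trans _ (f n)).
  by apply: IH => k kn; [apply: step|apply: stepC]; apply: ltnW.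
have [[Cn CSn]|nC] := pselect (C (f n) /\ C (f n.+1)).
  by apply: proj_close_both => //; apply: leq_trans (stepC n _ Cn CSn) (leq_addl _ _).
by apply: proj_closeW (lipC _ _ (step n _) nC); rewrite ?leq_addr.
Qed.

Lemma proj_close_geod_off C f n : proj_lipschitz C -> geod S f n ->
  (forall k, k < n -> ~ (C (f k) /\ C (f k.+1))) ->
  proj_close C (f 0%N) (f n) (n * c + c).
Proof.
move=> lipC gf nC; have := @proj_close_chain C f n 0 lipC; rewrite addn0; apply.
  by move=> k kn; rewrite gf; lia.
by move=> k kn Ck CSk; case: (nC k kn).
Qed.

(* An edge of a geodesic inside a set of diameter 1 runs from a point nearest to
   the origin of the geodesic to a point nearest to its end. *)
Lemma geod_proj_edge C f n k B : (forall x y, C x -> C y -> d x y <= 1) ->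
  geod S f n -> k < n -> C (f k) -> C (f k.+1) ->
  proj_close C (f 0%N) (f n) B -> dX (f k) (f k.+1) <= B.
Proof.
move=> diamC gf kn Ck CSk; apply; split=> // w Cw.
  have := dist_triangle genS w (f 0%N) (f k.+1); have := diamC _ _ Cw CSk.
  by rewrite !gf; lia.
have := dist_triangle genS w (f k) (f n); have := diamC _ _ Ck Cw.
by rewrite [d (f n) w]distC // [d (f n) _]distC // !gf; lia.
Qed.

End Projection.

(** * Consequences of bounded coset penetration and of hyperbolicity *)

Section RelHyp.
Local Open Scope group_scope.
Variables (R : realType) (G : groupType) (X : set G) (I : Type) (H : I -> set G).
Hypotheses (genX : generates X) (gH : forall i, group_closed [in H i]).
Implicit Types (x y z u v w g : G) (f h q : nat -> G).
Local Notation S := (coned_off_generators X H).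
Local Notation d := (cayley_dist S).
Local Notation dX := (cayley_dist X).
Local Notation coset g i := (lcoset_set g (H i)).

Lemma letter_coned_off x : letter X x -> letter S x.
Proof. by case=> Xx; [left|right]; left. Qed.

Lemma letter_peripheral i x : H i x -> letter S x.
Proof. by left; right; exists i. Qed.

Lemma letter_coned_offE x : letter S x -> letter X x \/ exists i, H i x.
Proof.
case=> -[Xx|[i _ Hx]].
- by left; left.
- by right; exists i.
- by left; right.
- by right; exists i; rewrite -[x]invgK; apply: group_setV.
Qed.

Lemma generates_coned_off : generates S.
Proof.
move=> x; have [w [Xw wx]] := genX x; exists w; split=> // s /Xw.
exact: letter_coned_off.
Qed.
Local Notation genS := generates_coned_off.

Lemma dist_coned_off_le x y : d x y <= dX x y.
Proof.
rewrite /cayley_dist; have [w [Xw wE] <-] := word_lengthP genX (x^-1 * y).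
by apply: word_length_le; split=> // s /Xw; apply: letter_coned_off.
Qed.

Lemma coset_refl g i : coset g i g.
Proof. by apply/lcoset_setE; rewrite mulVg; apply: group_set1. Qed.

Lemma coset_diff g i x y : coset g i x -> coset g i y -> H i (x^-1 * y).
Proof.
move=> /lcoset_setE xg /lcoset_setE; apply: group_set_trans => //.
exact: group_set_sym.
Qed.

Lemma coset_diam g i x y : coset g i x -> coset g i y -> d x y <= 1.
Proof.
move=> xg yg; apply: word_length_letter; apply: letter_peripheral.
exact: coset_diff xg yg.
Qed.

(* [x, u] followed by the edge [u, v] is compared with a geodesic [x, v] that
   meets the coset only at [v]. *)
Lemma bcp_proj_lipschitz : bounded_coset_penetration R X H ->
  exists c, forall g i, proj_lipschitz X S c (coset g i).
Proof.
move=> bcp; have [|c bcpc] := bcp (2%:R)%R; first by rewrite ler1n.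
exists (Num.bound c) => g i.
(* By symmetry, [x] may be taken as the end at least as far from the coset. *)
suff lip x y u v : d x y <= 1 -> ~ (coset g i x /\ coset g i y) ->
    nearest S (coset g i) x u -> nearest S (coset g i) y v -> d y v <= d x u ->
    dX u v <= Num.bound c.
  move=> x y xy nC u v nu nv; have [le|le] := leqP (d y v) (d x u).
    exact: (lip x y).
  rewrite (distC genX); apply: (lip y x) => //; last exact: ltnW.
    by rewrite (distC genS).
  by move=> [? ?]; apply: nC.
move=> xy nC [Cu nu] [Cv nv] le; have [<-|/eqP uv] := pselect (u = v).
  by rewrite (distxx X).
pose m := d x u.
have [f [f0 fm gf]] := geod_exists genS x u; rewrite -/m in fm gf.
have uv1 : d u v = 1%N.
  have := coset_diam Cu Cv; case E : (d u v) => [|[]] // _.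
  by move/(dist_eq0 genS): E uv => ->; rewrite eqxx.
have fC k : k <= m -> coset g i (f k) -> k = m.
  by move=> km /nu; rewrite -f0 gf -/m ?f0; lia.
(* As [m <= d x v <= m + 1], either any geodesic will do, or [x] followed by a geodesic from [y] to
   [v] is one. *)
have [h [h0 hn gh hC]] : exists h, [/\ h 0 = x, h (d x v) = v, geod S h (d x v)
    & forall k, k <= d x v -> coset g i (h k) -> k = d x v].
  have mv := nu _ Cv; rewrite -/m in mv le.
  have xv := dist_triangle genS y x v.
  have [dm|dm] := eqVneq (d x v) m.
    have [h [h0 hn gh]] := geod_exists genS x v; exists h; split=> // k km /nu.
    by rewrite -h0 gh ?h0 -/m; lia.
  have dxv : d x v = m.+1 by lia.
  have dyv : d y v = m by lia.
  have dxy : d x y = 1%N by lia.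
  have [t [t0 tn gt]] := geod_exists genS y v; rewrite dyv in tn gt.
  exists (fun k => if k is k'.+1 then t k' else x); rewrite dxv; split=> //.
    move=> [|j] [|k] jk; rewrite ?(distxx S) //; last by rewrite gt; lia.
    have := dist_triangle genS y x (t k); have := dist_triangle genS (t k) x v.
    have : d (t k) v = m - k by rewrite -tn gt; lia.
    have : d y (t k) = k by rewrite -t0 gt; lia.
    lia.
  move=> [|k] km; first last.
    move=> /nv; have -> : d y (t k) = k by rewrite -t0 gt; lia.
    by rewrite dyv; lia.
  move=> Cx; case: nC; split=> //; have := nu _ Cx; rewrite (distxx S) -/m => m0.
  by suff -> : y = v by []; apply: (dist_eq0 genS); lia.
(* The added edge may bring no extra distance: from [f j] with [j < m] the length is [m + 1 - j] and
   the distance at least [m - j], whence the factor 2. *)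
pose fv k := if k <= m then f k else v.
have qp : quasi_geodesic S (2%:R : R)%R 0%R (epath_of fv m.+1).
  apply: (quasi_geodesic_epath genS) => [k|j k]; rewrite /fv.
    rewrite ltnS => km; rewrite km; have [->|km'] := eqVneq k m.
      by rewrite ltnn fm uv1.
    by rewrite ltn_neqAle km' km gf; lia.
  have [km|mk] := leqP k m; have [jm|mj] := leqP j m; try lia.
    by move=> jk; rewrite gf; lia.
  move=> jk; have [->|jm'] := eqVneq j m; first by rewrite fm uv1; lia.
  have := nu _ Cv; have := dist_triangle genS (f j) x v.
  have -> : d x (f j) = j by rewrite -f0 gf; lia.
  by rewrite -/m; lia.
have qh : quasi_geodesic S (2%:R : R)%R 0%R (epath_of h (d x v)).
  by apply: (quasi_geodesic_epath genS) => [k|j k] jk; rewrite gh; lia.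
have nb n q : quasi_geodesic S (2%:R : R)%R 0%R (epath_of q n) ->
    without_backtracking H (epath_of q n).
  move=> qq l j k.
  exact: (quasi_geodesic_isolated (gH l) (@letter_peripheral l) qq).
have fvm : fv m = u by rewrite /fv leqnn fm.
have fvS : fv m.+1 = v by rewrite /fv ltnn.
have [||_] := bcpc _ _ qp qh (nb _ _ qp) (nb _ _ qh).
- by rewrite /= /fv f0.
- by rewrite /terminus !plen_epath !vertex_epath // fvS.
(* The second clause is applied to the last edge of the path through [u], whose coset [h] does not
   penetrate. *)
move=> /(_ i g m m.+1); rewrite !vertex_epath // fvm fvS => bnd.
suff : ((dX u v)%:R < (Num.bound c)%:R :> R)%R by rewrite ltr_nat => /ltnW.
apply: Order.POrderTheory.le_lt_trans (unstable.ltr_bound c); apply: bnd.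
  split; last by rewrite vertex_epath // fvm.
  split; first by rewrite plen_epath !leqnn.
    move=> k km; have -> : k = m by lia.
    by rewrite nth_epath // fvm fvS; apply: coset_diff Cu Cv.
  (* A longer stretch would put [f m.-1] in the coset, before its first visit at [m]. *)
  move=> j k jm; rewrite plen_epath => km lab; split; last by lia.
  have [//|jm'] := eqVneq j m; have lt_jm : j < m by lia.
  have := lab m.-1; rewrite nth_epath ?prednK; try lia.
  rewrite fvm /fv leq_pred => /(_ _)/group_set_sym Hm.
  have := fC m.-1 (leq_pred _); suff: coset g i (f m.-1) by move=> C /(_ C); lia.
  apply/lcoset_setE; move/lcoset_setE: Cu => /group_set_trans; apply=> //.
  by apply: Hm => //; lia.
(* A component would give [h] two consecutive vertices in the coset, but only its last vertex is
   there. *)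
move=> [j [k [[jk lab _]]]]; rewrite plen_epath in jk.
rewrite vertex_epath; last by lia.
move=> Cj; have Sj : coset g i (h j.+1).
  apply/lcoset_setE; move/lcoset_setE: Cj => /group_set_trans; apply=> //.
  by have := lab j; rewrite nth_epath; [apply; lia|lia].
by have := hC _ _ Cj; have := hC _ _ Sj; lia.
Qed.

Lemma hyperbolic_slim : weakly_relatively_hyperbolic R X H ->
  exists D : nat, forall f q h n m l,
    geod S f n -> geod S q m -> geod S h l ->
    f n = q 0%N -> q m = h 0%N -> h l = f 0%N ->
    forall k, k <= n ->
      (exists2 j, j <= m & d (f k) (q j) <= D) \/
      (exists2 j, j <= l & d (f k) (h j) <= D).
Proof.
case=> D slim; exists (Num.bound D) => f q h n m l gf gq gh fq qh hf k kn.
have bnd x y : ((d x y)%:R <= D)%R -> d x y <= Num.bound D.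
  move=> xyD; rewrite -(ler_nat R); apply: Order.POrderTheory.le_trans xyD _.
  exact/Order.POrderTheory.ltW/unstable.ltr_bound.
have := slim _ _ _ (geodesic_epath genS gf) (geodesic_epath genS gq)
  (geodesic_epath genS gh).
rewrite /terminus !plen_epath !vertex_epath // => /(_ fq qh hf k kn).
by case=> -[j jb]; rewrite !vertex_epath // => /bnd; [left|right]; exists j.
Qed.

End RelHyp.

(** * A shortest conjugator and its translate *)

Section Conjugator.
Local Open Scope group_scope.
Variables (G : groupType) (X : set G) (I : Type) (H : I -> set G).
Hypotheses (genX : generates X) (gH : forall i, group_closed [in H i]).
Implicit Types (x y z u v w g : G) (f h q : nat -> G).
Local Notation S := (coned_off_generators X H).
Local Notation d := (cayley_dist S).
Local Notation dX := (cayley_dist X).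
Local Notation coset g i := (lcoset_set g (H i)).
Local Notation genS := (generates_coned_off H genX).

Variables D c : nat.
Hypothesis slim : forall f q h n m l,
    geod S f n -> geod S q m -> geod S h l ->
    f n = q 0%N -> q m = h 0%N -> h l = f 0%N ->
    forall k, k <= n ->
      (exists2 j, j <= m & d (f k) (q j) <= D) \/
      (exists2 j, j <= l & d (f k) (h j) <= D).
Hypothesis lip : forall g i, proj_lipschitz X S c (coset g i).

Lemma proj_close_word g i y z :
  proj_close X S (coset g i) y z (dX y z * (c + 1) + c).
Proof.
have [f [f0 fn gf]] := geod_exists genX y z; rewrite -{1}fn -{1}f0.
have step k : k < dX y z -> dX (f k) (f k.+1) = 1%N by move=> kn; rewrite gf; lia.
apply: (proj_close_chain genX genS (@lip g i)) => k kn; last by rewrite step.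
by apply: leq_trans (dist_coned_off_le H genX _ _) _; rewrite step.
Qed.

Lemma coned_off_edge y z : d y z = 1%N -> dX y z <= 1 \/ exists i, coset y i z.
Proof.
move=> /(letter_word_length1 genS) /(letter_coned_offE gH) [/word_length_letter yz|].
  by left.
by case=> i yz; right; exists i; apply/lcoset_setE.
Qed.

(** Either the edge is labelled by a letter of [X], or it lies in a peripheral coset and
    [geod_proj_edge] applies. *)
Lemma edge_proj_bound f n k B : geod S f n -> k < n ->
  (forall i, coset (f k) i (f k.+1) -> proj_close X S (coset (f k) i) (f 0%N) (f n) B) ->
  dX (f k) (f k.+1) <= 1 + B.
Proof.
move=> gf kn fB; have [|le1|[i Ci]] := @coned_off_edge (f k) (f k.+1).
- by rewrite gf; lia.
- exact: leq_trans le1 (leq_addr _ _).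
apply: leq_trans (leq_addl _ _).
apply: (geod_proj_edge genS _ gf kn (coset_refl gH _ i) Ci (fB i Ci)) => y z.
exact: (coset_diam X gH).
Qed.

Variables (a b x : G) (p : nat -> G) (L : nat).
Local Notation n := (word_length S x).
Hypotheses (hyp_a : hyperbolic_element H a) (abx : x^-1 * a * x = b).
Hypothesis min_x : forall z, z^-1 * a * z = b -> n <= word_length S z.
Hypotheses (gp : geod S p n) (p0 : p 0%N = 1) (pn : p n = x).
Hypotheses (aL : word_length X a <= L) (bL : word_length X b <= L).

Lemma conj_axE : a * x = x * b.
Proof. by rewrite -abx !mulgA mulgV mul1g. Qed.

(* Both [a * x] and [a^-1 * x] conjugate [a] to [b], so neither can be reached
   by a shortcut between the geodesic [p] and its translate. *)
Lemma translate_dist i j : i <= n -> j <= n ->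
  i <= j + d (p i) (a * p j) /\ j <= i + d (p i) (a * p j).
Proof.
move=> iN jN.
have e0 k : k <= n -> d 1 (p k) = k by move=> kn; rewrite -p0 gp; lia.
have en k : k <= n -> d (p k) x = n - k by move=> kn; rewrite -{1}pn gp; lia.
split.
  have : n <= word_length S (a^-1 * x).
    by apply: min_x; rewrite invgM invgK !mulgA mulgK.
  rewrite -/(d a x).
  have := dist_triangle genS (a * p j) a x; have := dist_triangle genS (p i) (a * p j) x.
  have -> : d a (a * p j) = j by rewrite -[a in d a _]mulg1 dist_mull e0.
  by rewrite (distC genS (a * p j) (p i)) (en i) //; lia.
have : n <= word_length S (a * x).
  by apply: min_x; rewrite invgM !mulgA mulgVK.
rewrite -(dist1 S (a * x)).
have := dist_triangle genS (p i) 1 (a * x).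
have := dist_triangle genS (a * p j) (p i) (a * x).
rewrite dist_mull (e0 i) // (en j) //; lia.
Qed.

(** Cosets have diameter 1, so [translate_dist] forces [l = k]; then [p k] and [a * p k] share a
    coset of [H i], making [a] parabolic. *)
Lemma no_common_coset g i k l : k < n -> l < n ->
  coset g i (p k) -> coset g i (p k.+1) ->
  coset g i (a * p l) -> coset g i (a * p l.+1) -> False.
Proof.
move=> kn ln Ck CSk Cl CSl.
have [_ le1] := translate_dist (ltnW kn) ln.
have [le2 _] := translate_dist kn (ltnW ln).
have := coset_diam X gH Ck CSl; have := coset_diam X gH CSk Cl => d1 d2.
have kl : l = k by lia.
rewrite kl in Cl; apply: hyp_a; exists i; exists ((p k)^-1 * (a * p k)).
  exact: (coset_diff gH Ck Cl).
by exists (p k)^-1; rewrite conjgE invgK !mulgA mulgV mul1g mulgK.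
Qed.

(** Slimness is used twice on the quadrilateral [1], [x], [x * b = a * x], [a], cut by a diagonal.
    The short sides are too far from [p k], so some [a * p j'] is within [2 * D]; by
    [translate_dist], [j'] and [k] differ by at most [2 * D]. *)
Lemma translate_close k : L + 2 * D < k -> k + L + 2 * D < n ->
  d (p k) (a * p k) <= 4 * D.
Proof.
move=> Lk kL; have kn : k <= n by lia.
have dk0 : d (p k) 1 = k by rewrite -p0 (distC genS) gp; lia.
have dkn : d (p k) x = n - k by rewrite -{1}pn gp; lia.
have [beta [beta0 betan gbeta]] := geod_exists genS x (x * b).
have [gam [gam0 gamn ggam]] := geod_exists genS (x * b) 1.
have [alf [alf0 alfn galf]] := geod_exists genS 1 a.
have dxb : d x (x * b) <= L.
  by rewrite -[x in d x _]mulg1 dist_mull dist1 (leq_trans _ bL) // -!(dist1 S)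
     (leq_trans (dist_coned_off_le H genX _ _)) // dist1.
have d1a : d 1 a <= L by rewrite (leq_trans (dist_coned_off_le H genX _ _)) // dist1.
have := slim gp gbeta ggam; rewrite pn beta0 betan gam0 gamn p0.
move=> /(_ erefl erefl erefl k kn); case.
  case=> j jm near; have := gbeta 0%N j; rewrite beta0.
  by have := dist_triangle genS (beta j) (p k) x; rewrite (distC genS (beta j)); lia.
case=> j jm near.
have := slim ggam galf (geod_mull a gp); rewrite gamn alf0 alfn p0 mulg1 gam0 pn conj_axE.
move=> /(_ erefl erefl erefl j jm); case.
  case=> j' jm' near'; have := galf 0%N j'; rewrite alf0.
  have := dist_triangle genS (gam j) (p k) (alf j').
  by have := dist_triangle genS (alf j') (p k) 1; rewrite (distC genS (alf j')); lia.
case=> j' jn near'.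
have := dist_triangle genS (gam j) (p k) (a * p j').
have := dist_triangle genS (a * p j') (p k) (a * p k); rewrite dist_mull.
have := @gp (minn j' k) (maxn j' k); have := translate_dist kn jn.
have [jk|jk] := leqP j' k; last by rewrite (distC genS (p j')); lia.
by lia.
Qed.

(** The detour runs from [p k'] across to [a * p k'], along the translate, and back to [p k'']; by
    [no_common_coset] its middle part has no edge in the coset. *)
Lemma edge_bound_sides k' k k'' B : k' <= k < k'' -> k'' <= n ->
  (forall i, coset (p k) i (p k.+1) ->
    proj_close X S (coset (p k) i) (p k') (a * p k') B /\
    proj_close X S (coset (p k) i) (p k'') (a * p k'') B) ->
  dX (p k) (p k.+1) <= 1 + (B + ((k'' - k') * c + c) + B).
Proof.
move=> kk kn sides; have gf : geod S (fun t => p (k' + t)) (k'' - k').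
  by apply: geod_prefix gp _; lia.
have := @edge_proj_bound _ _ (k - k') (B + ((k'' - k') * c + c) + B) gf.
rewrite /= addnS !subnKC ?addn0; try lia.
apply; first by lia.
move=> i Ci; have [s1 s2] := sides i Ci.
apply: (proj_close_trans genX _ (proj_closeC genX s2)); apply: (proj_close_trans genX s1).
have := proj_close_geod_off genX genS (@lip (p k) i) (geod_mull a gf).
rewrite /= addn0 subnKC; last by lia.
apply=> t tk [Ct]; rewrite addnS => CSt.
by apply: no_common_coset (coset_refl gH _ i) Ci Ct CSt; lia.
Qed.

(** The detour around all of [p], with the words [a] and [b] as sides. *)
Lemma edge_bound k : k < n ->
  dX (p k) (p k.+1) <= 1 + (L * (c + 1) + c + (n * c + c) + (L * (c + 1) + c)).
Proof.
move=> kn; rewrite -{1}[n]subn0; apply: edge_bound_sides => // i _.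
rewrite p0 mulg1 pn conj_axE; split; apply: (proj_closeW _ (@proj_close_word _ _ _ _)).
  by rewrite leq_add2r leq_mul2r dist1 aL orbT.
by rewrite leq_add2r leq_mul2r -[x in dX x _]mulg1 dist_mull dist1 bL orbT.
Qed.

(** [N] is the margin required by [translate_close]. Moving [M] along [p] leaves a coset that comes
    within [4 * D] of the start at distance more than [4 * D], as [M - 1 - 4 * D = 4 * D + 1]. *)
Local Notation M := (8 * D + 2).
Local Notation N := (L + 2 * D + 1).

(** A geodesic from [p k] to [a * p k] stays within [4 * D] of [p k], hence misses the coset. *)
Lemma side_off g i k : N <= k -> k + N <= n ->
  (forall w, coset g i w -> 4 * D < d (p k) w) ->
  proj_close X S (coset g i) (p k) (a * p k) (4 * D * c + c).
Proof.
move=> Nk kN far; have close : d (p k) (a * p k) <= 4 * D.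
  by apply: translate_close; lia.
have [f [f0 fn gf]] := geod_exists genS (p k) (a * p k).
have := proj_close_geod_off genX genS (@lip g i) gf; rewrite f0 fn => H0.
apply: (@proj_closeW _ _ _ _ _ _ (d (p k) (a * p k) * c + c)); last apply: H0.
  by rewrite leq_add2r leq_mul2r close orbT.
by move=> j jn [/far]; have := gf 0%N j; rewrite f0; lia.
Qed.

Definition deep_edge_bound : nat :=
  1 + (4 * D * c + c + ((2 * M + 1) * c + c) + (4 * D * c + c)).

Lemma deep_edge k : N + M <= k -> k + M + N < n ->
  dX (p k) (p k.+1) <= deep_edge_bound.
Proof.
move=> Nk kN; rewrite /deep_edge_bound.
have -> : 2 * M + 1 = (k + M + 1) - (k - M) by lia.
apply: edge_bound_sides => [||i Ci]; try lia.
have far w j : coset (p k) i w -> j <= n -> maxn k j - minn k j <= 1 + d (p j) w.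
  move=> /(coset_diam X gH (coset_refl gH (p k) i)) d1 jn.
  have := dist_triangle genS w (p j) (p k); rewrite (distC genS w).
  have := @gp (minn k j) (maxn k j).
  by have [jk|jk] := leqP j k; rewrite ?(distC genS (p k) (p j)); lia.
split; apply: side_off; try lia; move=> w /far.
  by move/(_ (k - M)); lia.
by move/(_ (k + M + 1)); lia.
Qed.

(** Independent of [L], so that one finite ball serves all pairs [a], [b]. *)
Definition deep_displacement : nat :=
  (let B := M * (c + deep_edge_bound) + c in
   4 * D * (1 + (B + (4 * D * c + c) + B)))%N.

(** Each of the at most [4 * D] edges of a geodesic from [p k] to [a * p k] is bounded by the detour
    through [p (k + M)] and [a * p (k + M)]. *)
Lemma deep_close k : N + M <= k -> k + 2 * M + N <= n ->
  dX (p k) (a * p k) <= deep_displacement.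
Proof.
move=> Nk kN; rewrite /deep_displacement; set B := (_ * (c + _) + c)%N.
have close : d (p k) (a * p k) <= 4 * D by apply: translate_close; lia.
have [f [f0 fn gf]] := geod_exists genS (p k) (a * p k).
rewrite -{1}fn -{1}f0.
apply: leq_trans (leq_mul close (leqnn _)).
apply: (dist_chain genX) => j jn; apply: (edge_proj_bound gf) => // i Ci.
rewrite f0 fn.
(* Used for [s = 1] and [s = a]: translation preserves the [X]-length of edges. *)
have chain s : proj_close X S (coset (f j) i) (s * p k) (s * p (k + M)) B.
  have := @proj_close_chain _ X S genX genS c (coset (f j) i) (fun t => s * p (k + t)) M
    deep_edge_bound (@lip _ _).
  rewrite addn0; apply=> t tM; rewrite dist_mull addnS; first by rewrite gp; lia.
  by move=> _ _; apply: deep_edge; lia.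
have ch1 := chain 1; rewrite !mul1g in ch1.
apply: (@proj_close_trans _ X S genX _ (a * p (k + M))); last first.
  exact/(proj_closeC genX)/chain.
apply: (@proj_close_trans _ X S genX _ (p (k + M))).
  exact: ch1.
apply: side_off; try lia; move=> w /(coset_diam X gH (coset_refl gH (f j) i)) d1.
have := dist_triangle genS (f j) (p k) w; have := dist_triangle genS w (p k) (p (k + M)).
have := gf 0%N j; have := @gp k (k + M); rewrite f0 (distC genS w); lia.
Qed.

(** If two conjugates agree, cutting out the stretch of [p] between them leaves a shorter
    conjugator. *)
Lemma conjugates_inj j k : j <= n -> k <= n ->
  (p j)^-1 * a * p j = (p k)^-1 * a * p k -> j = k.
Proof.
wlog jk : j k / j <= k => [hw|] jn kn e.
  by case/orP: (leq_total j k) => ?; [apply: hw|apply/esym/hw].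
have : n <= word_length S (p j * ((p k)^-1 * x)).
  apply: min_x; transitivity (x^-1 * p k * ((p j)^-1 * a * p j) * (p k)^-1 * x).
    by rewrite !invgM invgK !mulgA.
  by rewrite e -abx !mulgA !mulgK.
have := word_lengthM genS (p j) ((p k)^-1 * x).
have : word_length S (p j) = j by rewrite -(dist1 S) -p0 gp; lia.
have : word_length S ((p k)^-1 * x) = n - k by rewrite -{1}pn -/(d _ _) gp; lia.
lia.
Qed.

Lemma conjugator_length (s : seq G) :
  (forall y, word_length X y <= deep_displacement -> y \in s) ->
  n <= 2 * N + 3 * M + size s.
Proof.
move=> sP; pose t := [seq (p k)^-1 * a * p k | k <- iota (N + M) (n - (2 * N + 3 * M))].
have ut : uniq t.
  rewrite map_inj_in_uniq ?iota_uniq // => j k; rewrite !mem_iota => jb kb.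
  by apply: conjugates_inj; lia.
have : {subset t <= s}.
  move=> y /mapP[k]; rewrite mem_iota => kb ->; apply: sP.
  by rewrite -mulgA; apply: deep_close; lia.
by move/(uniq_leq_size ut); rewrite size_map size_iota leq_subLR.
Qed.

End Conjugator.

(** * The cubic bound *)

Local Open Scope ring_scope.

Theorem theorem3p6 (R : realType) (G : groupType) (X : set G)
    (I : Type) (H : I -> set G) :
  finite_set X -> generates X ->
  (forall i, group_closed [in H i]) ->
  relatively_hyperbolic R X H ->
  exists2 Q : {poly R}, size Q = 4%N &
    forall a b : G,
      hyperbolic_element H a -> hyperbolic_element H b ->
      (exists y : G, (y^-1 * a * y)%g = b) ->
      exists2 x : G, (x^-1 * a * x)%g = b &
        (word_length X x)%:R <=
          Q.[(maxn (word_length X a) (word_length X b))%:R].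
Proof.
move=> finX genX gH [/(hyperbolic_slim genX)[D slim] /(bcp_proj_lipschitz genX gH)[c lip]].
have [s sP] := finite_ball genX finX (deep_displacement D c).
(* [E] gives [n <= E * (L + 1)], its final 2 absorbing the [2 * L] in [2 * N]; [A] is the resulting
   coefficient of [(L + 1) ^ 2]. *)
pose E := (2 * (2 * D + 1) + 3 * (8 * D + 2) + size s + 2)%N.
pose A := (E * (1 + (c + 1 + c + (E * c + c) + (c + 1 + c))))%N.
have A_neq0 : A%:R != 0 :> R.
  by rewrite pnatr_eq0 muln_eq0 negb_or /E addn2 add1n.
exists (A%:R *: ('X + 1%:P) ^+ 3) => [|a b hyp_a _ [y0 y0P]].
  by rewrite size_scale // -[1]opprK polyCN size_exp_XsubC.
pose S := coned_off_generators X H.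
pose P n := `[< exists2 z, (z^-1 * a * z)%g = b & word_length S z = n >].
have exP : exists n, P n by exists (word_length S y0); apply/asboolP; exists y0.
case: (ex_minnP exP) => _ /asboolP[x abx <-] minP.
have min_x z : (z^-1 * a * z)%g = b -> (word_length S x <= word_length S z)%N.
  by move=> zab; apply: minP; apply/asboolP; exists z.
exists x => //; set L := maxn _ _.
have [aL bL] : (word_length X a <= L)%N /\ (word_length X b <= L)%N.
  by rewrite leq_maxl leq_maxr.
have [p [p0 pn gp]] := geod_exists (generates_coned_off H genX) 1%g x.
rewrite dist1 in pn gp.
have nL := conjugator_length genX gH slim lip hyp_a abx min_x gp p0 pn aL bL sP.
have xn : (word_length X x <= word_length S x * (1 + (L * (c + 1) + c
    + (word_length S x * c + c) + (L * (c + 1) + c))))%N.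
  rewrite -(dist1 X) -{1}pn -p0; apply: (dist_chain genX) => k kn.
  exact: (edge_bound genX gH lip hyp_a abx min_x gp p0 pn aL bL).
have nE : (word_length S x <= E * (L + 1))%N.
  by apply: leq_trans nL _; rewrite /E; nia.
rewrite hornerZ horner_exp hornerD hornerX hornerC -(natrD _ _ 1) -natrX -natrM ler_nat.
(* The estimate is quadratic; a spare factor [L + 1] makes it cubic. *)
apply: leq_trans xn _; apply: (@leq_trans (A * (L + 1) ^ 2)); last first.
  by rewrite leq_mul2l leq_pexp2l ?orbT // addn1.
rewrite /A expnS expn1 mulnACA; apply: leq_mul => //.
have LL : (word_length S x * c <= E * (L + 1) * c)%N by rewrite leq_mul2r nE orbT.
by nia.
Qed.
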